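(* There is no deterministic (adaptive) priority algorithm that achieves an asymptotic approximation ratio greater than $1/2$ for one-sided bipartite matching, even if the algorithm knows the size of the graph.
   Context: One-sided bipartite matching: the offline side's vertex names are known in advance; each online vertex corresponds to a data item consisting of its name together with its set of offline neighbours; when a data item is received the algorithm must irrevocably match that online vertex to an unmatched neighbour or leave it unmatched; the goal is a maximum-size matching. Adaptive priority model: before each step the algorithm specifies an arbitrary total ordering $\pi$ of the universe of all possible data items (which may depend on all previously received data items and decisions, but not on unseen ones), and receives the remaining data item of the instance that comes first in $\pi$, about which it then makes its irrevocable decision. The asymptotic approximation ratio of $\mathbb{A}$ is $\liminf_{n}\inf_{I\in\mathcal{I}_n} v(\mathbb{A},I)/v(I)$, with $v(I)$ the maximum matching size. *)

(* Defs.v *)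
From HB Require Import structures.
From mathcomp Require Import all_boot all_order all_algebra.
From mathcomp Require Import finmap.
Set Implicit Arguments. Unset Strict Implicit. Unset Printing Implicit Defensive.
Import Order.TTheory GRing.Theory Num.Theory.
Local Open Scope fset_scope.

(* Offline and online vertex names are natural numbers.
   A data item = (online vertex name, set of offline neighbours).
   The universe of all possible data items is the type [item]. *)
Definition item := (nat * {fset nat})%type.

(* History: received data items together with the irrevocable decision
   (Some u = matched to offline vertex u, None = left unmatched). *)
Definition hist := seq (item * option nat).

Definition matched (h : hist) : seq nat := pmap snd h.

Definition total_order (le : rel item) : Prop :=
  [/\ forall x y, le x y || le y x,
      antisymmetric le &
      transitive le].

(* A deterministic adaptive priority algorithm.  It knows the offline
   vertex set U and the number m of online vertices (hence the size of the
   graph).  Before each step it chooses a total order of the universe as a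
   function of everything seen so far (the history), and after receiving an
   item it decides (deterministically) as a function of the history and the
   item. *)
Record priority_algorithm := PriorityAlgorithm {
  pa_order : {fset nat} -> nat -> hist -> rel item;
  pa_decide : {fset nat} -> nat -> hist -> item -> option nat;
  pa_order_total : forall U m h, total_order (pa_order U m h)
}.

Definition first_in (le : rel item) (s : seq item) : option item :=
  foldr (fun x acc => match acc with
                      | None => Some x
                      | Some y => if le x y then Some x else Some y
                      end) None s.

Definition effective (h : hist) (x : item) (d : option nat) : option nat :=
  match d with
  | Some u => if (u \in x.2) && (u \notin matched h) then Some u else None
  | None => None
  end.

Fixpoint run (A : priority_algorithm) (U : {fset nat}) (m : nat)
    (fuel : nat) (h : hist) (s : seq item) : hist :=
  match fuel with
  | 0 => h
  | fuel'.+1 =>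
      match first_in (pa_order A U m h) s with
      | None => h
      | Some x =>
          let d := effective h x (pa_decide A U m h x) in
          run A U m fuel' (rcons h (x, d)) (rem x s)
      end
  end.

Definition alg_value (A : priority_algorithm) (U : {fset nat}) (I : seq item) : nat :=
  size (matched (run A U (size I) (size I) [::] I)).

Definition valid_instance (U : {fset nat}) (I : seq item) : Prop :=
  uniq (map fst I) /\ all (fun x => x.2 `<=` U) I.

Definition is_matching (I : seq item) (M : seq (item * nat)) : Prop :=
  [/\ uniq (map fst M), uniq (map snd M) &
      all (fun p => (p.1 \in I) && (p.2 \in p.1.2)) M].

Definition max_matching (I : seq item) (M : seq (item * nat)) : Prop :=
  is_matching I M /\ forall M', is_matching I M' -> (size M' <= size M)%N.

Definition graph_size (U : {fset nat}) (I : seq item) : nat := (#|` U| + size I)%N.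

(* Main.v *)
(* Fix k, an offline side of size 2k and 2k-1 online vertices.  The adversary
   maintains a set W of offline vertices, initially all of U, and as candidate
   items all pairs of an unused name and a k-subset of W.  For k-1 rounds it hands
   out the candidate (x, N) that the algorithm ranks first; as at most k-2
   vertices are matched so far, N contains a vertex v which is still free after
   the algorithm's decision.  The optimum will match x to v, and the adversary
   deletes v from W, so that the algorithm never uses v.  Finally, |W| = k+1 and
   the k remaining online vertices all get the same k-subset of W as their
   neighbourhood.  The optimum is 2k-1, while the algorithm only ever matches
   vertices of the final W, so it gets at most k+1. *)
Require Import Defs.
From HB Require Import structures.
From mathcomp Require Import all_boot all_order all_algebra.
From mathcomp Require Import finmap.
From mathcomp Require Import zify lra.
Import Order.TTheory GRing.Theory Num.Theory.
Local Open Scope fset_scope.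
Local Open Scope ring_scope.

Lemma first_in_least (le : rel item) (s : seq item) :
  total_order le -> s != [::] ->
  exists x, [/\ first_in le s = Some x, x \in s & {in s, forall y, le x y}].
Proof.
move=> [tot _ tr]; elim: s => // a s IH _.
have refl z : le z z by have := tot z z; rewrite orbb.
have [->|s_neq0] := eqVneq s [::].
  by exists a; split=> [//||y]; rewrite inE // => /eqP ->.
have [x [fx xs x_min]] := IH s_neq0.
rewrite /= -/(first_in le s) fx.
have [ax|nax] := boolP (le a x).
  exists a; split=> [//||y]; rewrite inE ?eqxx // => /predU1P[->//|ys].
  exact: tr ax (x_min y ys).
exists x; split=> [//||y]; rewrite inE ?xs ?orbT // => /predU1P[->|/x_min//].
by have := tot a x; rewrite (negbTE nax).
Qed.

Lemma first_in_eq (le : rel item) (s : seq item) (x : item) :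
  total_order le -> x \in s -> {in s, forall y, le x y} -> first_in le s = Some x.
Proof.
move=> le_tot xs x_min.
have s_neq0 : s != [::] by case: s xs {x_min}.
have [y [-> ys y_min]] := first_in_least le s le_tot s_neq0.
case: le_tot => _ anti _; congr Some; apply: anti.
by rewrite y_min // x_min.
Qed.

Lemma matched_rcons (h : hist) (x : item) (d : option nat) :
  matched (rcons h (x, d)) = matched h ++ oapp (fun u => [:: u]) [::] d.
Proof. by rewrite /matched -cats1 pmap_cat; case: d. Qed.

Lemma effective_some (h : hist) (x : item) (d : option nat) (u : nat) :
  effective h x d = Some u -> u \in x.2 /\ u \notin matched h.
Proof. by case: d => //= v; case: ifP => // /andP[? ?] [<-]. Qed.

Lemma matched_step (h : hist) (x : item) (d : option nat) (W : {fset nat}) :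
  uniq (matched h) -> {subset matched h <= W} -> x.2 `<=` W ->
  let h' := rcons h (x, effective h x d) in
  uniq (matched h') /\ {subset matched h' <= W}.
Proof.
move=> uh hW /fsubsetP xW /=; rewrite matched_rcons.
case E: (effective h x d) => [u|] /=; last by rewrite cats0.
have [ux uh'] := effective_some _ _ _ _ E.
split; first by rewrite cats1 rcons_uniq uh'.
by move=> z; rewrite mem_cat inE => /orP[/hW//|/eqP->]; apply: xW.
Qed.

Lemma run_step (A : priority_algorithm) (U : {fset nat}) (m n : nat)
    (h : hist) (s : seq item) (x : item) :
  first_in (pa_order A U m h) s = Some x ->
  run A U m n.+1 h s =
    run A U m n (rcons h (x, effective h x (pa_decide A U m h x))) (rem x s).
Proof. by move=> /= ->. Qed.

(** Each new match is a neighbour in [W] that was free before, so the matched vertices remain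
    distinct elements of [W], whatever the orders and decisions. *)
Lemma size_matched_run (A : priority_algorithm) (U : {fset nat}) (m n : nat)
    (h : hist) (s : seq item) (W : {fset nat}) :
  uniq (matched h) -> {subset matched h <= W} -> {in s, forall x, x.2 `<=` W} ->
  (size (matched (run A U m n h s)) <= #|` W|)%N.
Proof.
elim: n h s => [|n IH] h s uh hW sW /=; first exact: uniq_leq_size.
case: (eqVneq s [::]) => [->|s_neq0] /=; first exact: uniq_leq_size.
have [x [-> xs _]] := first_in_least _ _ (pa_order_total A U m h) s_neq0.
have [uh' hW'] := matched_step _ _ (pa_decide A U m h x) _ uh hW (sW x xs).
by apply: IH => // y /mem_rem; apply: sW.
Qed.

Lemma fsubset_card_exists (W : {fset nat}) (k : nat) :
  (k <= #|` W|)%N -> exists2 N : {fset nat}, N `<=` W & #|` N| = k.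
Proof.
move=> kW; exists [fset x in take k W].
  by apply/fsubsetP => x; rewrite inE /= => /mem_take.
by rewrite card_fseq undup_id ?take_uniq ?fset_uniq // size_takel.
Qed.

(** Induction on the number [j] of adversary rounds left, from an arbitrary history, so that the run
    can resume after each round. A round removes one vertex from [W] and one name from [ns] and adds
    at most one match, which preserves the size hypotheses. The equation [map fst M = I] makes [M]
    saturate the online side. *)
Lemma adversary (A : priority_algorithm) (U : {fset nat}) (m k j : nat)
    (h : hist) (ns : seq nat) (W : {fset nat}) :
  uniq ns -> size ns = (j + k)%N -> #|` W| = (k + j).+1 ->
  uniq (matched h) -> {subset matched h <= W} ->
  (size (matched h) + j < k)%N ->
  exists (I : seq item) (M : seq (item * nat)),
    [/\ perm_eq (map fst I) ns,
        {in I, forall x, x.2 `<=` W /\ #|` x.2| = k},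
        map fst M = I,
        uniq (map snd M) /\ {in M, forall p, p.2 \in p.1.2} &
        (size (matched (run A U m (size I) h I)) <= k.+1)%N].
Proof.
elim: j h ns W => [|j IH] h ns W uns sns cW uh hW hk.
  have [|N NW cN] := fsubset_card_exists W k; first by rewrite cW; lia.
  have sN : size ns = size N by rewrite sns -cN.
  pose I : seq item := [seq (x, N) | x <- ns].
  have sI : size I = size N by rewrite size_map.
  exists I, (zip I N); split.
  - by rewrite -map_comp map_id.
  - by move=> x /mapP[y _ ->].
  - by rewrite -/unzip1 unzip1_zip ?sI.
  - have -> : map snd (zip I N) = N by rewrite -/unzip2 unzip2_zip ?sI.
    split; first exact: fset_uniq.
    move=> [p u] pu; have /= uN := map_f snd pu; have /= pI := map_f fst pu.
    move: uN pI; rewrite -/unzip1 -/unzip2 unzip1_zip ?unzip2_zip ?sI //.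
    by move=> uN /mapP[y _ ->].
  - have -> : k.+1 = #|` W| by rewrite cW addn0.
    by apply: size_matched_run => // x /mapP[y _ ->].
pose C : seq item := [seq (x, N) | x <- ns, N <- [seq N <- fpowerset W | #|` N| == k]].
have memC (x : item) : x \in C = [&& x.1 \in ns, x.2 `<=` W & #|` x.2| == k].
  apply/(allpairsPdep (T := fun=> {fset nat}))/and3P => [[y [N [yns]]]|[xns xW xk]].
    by rewrite mem_filter fpowersetE => /andP[cN NW] ->.
  exists x.1, x.2.
  by rewrite mem_filter fpowersetE xk xW xns -surjective_pairing.
have C_neq0 : C != [::].
  have [|N NW cN] := fsubset_card_exists W k; first by rewrite cW; lia.
  have: (head 0%N ns, N) \in C.
    by rewrite memC /= NW cN eqxx !andbT; case: (ns) sns => //= *; rewrite inE eqxx.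
  by case: (C).
have le_tot := pa_order_total A U m h.
have [x [_ xC x_min]] := first_in_least _ _ le_tot C_neq0.
move: (xC); rewrite memC => /and3P[xns xW /eqP xk].
pose d := effective h x (pa_decide A U m h x); pose h' := rcons h (x, d).
have [uh' hW'] := matched_step _ _ (pa_decide A U m h x) _ uh hW xW.
rewrite -/d -/h' in uh' hW'.
have sh' : (size (matched h') <= (size (matched h)).+1)%N.
  by rewrite matched_rcons size_cat; case: (d) => [u|] /=; lia.
(* Pigeonhole: [h'] has at most one match more than [h], hence fewer than [k], too few to cover the
   [k] vertices of [x.2]. *)
have [v vx vh'] : exists2 v, v \in x.2 & v \notin matched h'.
  apply/allPn/negP => /allP sub; have kh := uniq_leq_size (fset_uniq _) sub.
  by move: (leq_trans kh sh'); rewrite xk; lia.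
have vW : v \in W by move/fsubsetP: xW; apply.
have [||||||I [M [names nbhs MI [uM Mnb] alg]]] := IH h' (rem x.1 ns) (W `\ v).
- exact: rem_uniq.
- by rewrite size_rem // sns.
- by move: cW; rewrite (cardfsD1 v) vW; lia.
- exact: uh'.
- move=> u uh''; rewrite !inE hW' // andbT.
  by apply: contra vh' => /eqP <-.
- by lia.
have nbhsW y : y \in I -> y.2 `<=` W /\ #|` y.2| = k.
  by move=> /nbhs[yW yk]; split=> //; apply: fsubset_trans yW (fsubD1set _ _).
exists (x :: I), ((x, v) :: M); split.
- by rewrite perm_sym (permPl (perm_to_rem xns)) perm_cons perm_sym.
- by move=> y; rewrite inE => /predU1P[->//|/nbhsW].
- by rewrite /= MI.
- split=> /=; last by move=> p; rewrite inE => /predU1P[->//|/Mnb].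
  (* The rest of [M] only uses neighbourhoods inside [W] without [v]. *)
  rewrite uM andbT; apply/mapP => -[p pM vp].
  have /nbhs[/fsubsetP pW _] : p.1 \in I by rewrite -MI map_f.
  by have := pW _ (Mnb p pM); rewrite -vp !inE eqxx.
- have fx : first_in (pa_order A U m h) (x :: I) = Some x.
    apply: first_in_eq le_tot _ _; rewrite ?inE ?eqxx // => y.
    rewrite inE => /predU1P[->|yI]; apply: x_min; rewrite // memC.
    have [-> ->] := nbhsW y yI; rewrite eqxx !andbT.
    by apply: (mem_rem (x := x.1)); rewrite -(perm_mem names) map_f.
  by rewrite (run_step _ _ _ _ _ _ _ fx) /= eqxx.
Qed.

(* The asymptotic approximation ratio liminf_n inf_{I in I_n} v(A,I)/v(I)
   is at most 1/2: for every eps > 0 and every N there is an instance of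
   size n >= N with 0 < v(I) and v(A,I)/v(I) < 1/2 + eps. *)
Theorem theorem7 (A : priority_algorithm) (eps : rat) :
  0 < eps ->
  forall N : nat,
  exists (U : {fset nat}) (I : seq item) (M : seq (item * nat)),
    [/\ valid_instance U I,
        (N <= graph_size U I)%N,
        max_matching I M,
        (0 < size M)%N &
        (alg_value A U I)%:R / (size M)%:R < 1 / 2 + eps].
Proof.
move=> eps_gt0 N.
(* The final inequality k + 1 < (1/2 + eps)(2k - 1) amounts to 3/2 < eps (2k - 1), and eps (2k - 1)
   >= eps k > 2. *)
have [k [k_gt1 N_le_k k_gt]] : exists k, [/\ (1 < k)%N, (N <= k)%N & 2 / eps < k%:R].
  exists (N + Num.bound (2 / eps)).+2; split; [lia..|].
  have := archi_boundP (divr_ge0 (ler0n _ 2) (ltW eps_gt0)).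
  by move/lt_le_trans; apply; rewrite ler_nat !leqW // leq_addl.
pose U := [fset i in iota 0 (2 * k)].
have cU : #|` U| = (2 * k)%N by rewrite card_fseq undup_id ?iota_uniq ?size_iota.
have [||||||I [M [names nbhs MI [uM Mnb] alg]]] :=
  adversary A U (2 * k).-1 k k.-1 [::] (iota 0 (2 * k).-1) U.
- exact: iota_uniq.
- by rewrite size_iota; lia.
- by rewrite cU; lia.
- by [].
- by [].
- by rewrite /=; lia.
have sI : size I = (2 * k).-1.
  by rewrite -(size_map fst) (perm_size names) size_iota.
have sM : size M = (2 * k).-1 by rewrite -sI -MI size_map.
have uI : uniq (map fst I) by rewrite (perm_uniq names) iota_uniq.
exists U, I, M; split.
- by split=> //; apply/allP => x /nbhs[].
- by rewrite /graph_size cU; lia.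
- split.
    split=> //; first by rewrite MI (map_uniq uI).
    by apply/allP => p pM; rewrite Mnb // -MI map_f.
  (* No matching has more edges than there are online vertices, and [M] uses them all. *)
  move=> M' [uM' _ /allP M'I]; rewrite sM -sI -(size_map fst M').
  by apply: uniq_leq_size uM' _ => y /mapP[p /M'I/andP[? _] ->].
- by rewrite sM; lia.
rewrite /alg_value sI sM in alg *.
have sM_gt0 : 0 < (2 * k).-1%:R :> rat by rewrite ltr0n; lia.
rewrite ltr_pdivrMr //.
apply: (@le_lt_trans _ _ k.+1%:R); first by rewrite ler_nat.
have -> : (2 * k).-1%:R = 2 * k%:R - 1 :> rat.
  by rewrite -subn1 natrB ?natrM // muln_gt0 /= ltnW.
rewrite -natr1; move: k_gt; rewrite ltr_pdivrMr // => k_gt.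
have k_ge1 : 1 <= k%:R :> rat by rewrite ler1n ltnW.
nra.
Qed.
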